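(* Let $p\in\mathcal H$ be a CM point. For $\Delta>0$ let $\mathrm{RM}^p_\Delta$ denote the set of RM curves passing through $p$ with discriminant $D\le\Delta$, and let $\mathrm{ang}_p\,\mathrm{RM}^p_\Delta=\{\mathrm{ang}_p(G): G\in \mathrm{RM}^p_\Delta\}\subseteq[0,\pi]$. Then, as $\Delta\to\infty$, the angles $\mathrm{ang}_p\,\mathrm{RM}^p_\Delta$ are equidistributed over $[0,\pi]$ with respect to the uniform measure $d\theta$; that is, for all compact intervals $I_1\subseteq I_2\subseteq[0,\pi]$ with $I_2$ of nonzero length, $$\lim_{\Delta\to\infty}\frac{\#\,(I_1\cap \mathrm{ang}_p\,\mathrm{RM}^p_\Delta)}{\#\,(I_2\cap \mathrm{ang}_p\,\mathrm{RM}^p_\Delta)}=\frac{\mathrm{length}(I_1)}{\mathrm{length}(I_2)}.$$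
   Context: $\mathcal H=\{z=x+iy\in\mathbb C: y>0\}$. A binary quadratic form is an integer triple $(a,b,c)$ (standing for $ax^2+bxy+cy^2$), with discriminant $b^2-4ac$; it is normalized if $\gcd(a,b,c)=1$ and the first nonzero entry of $(a,b,c)$ is positive. A CM point is the root in $\mathcal H$ of $az^2+bz+c$, where $(a,b,c)$ is a normalized binary quadratic form of negative discriminant. An RM curve is the semicircle in $\mathcal H$ (centered on the real axis) connecting the two real roots of $az^2+bz+c$, where $(a,b,c)$ is a normalized binary quadratic form of positive discriminant with $a\ne0$; its discriminant is $b^2-4ac$. For $q\in\mathbb R$, $r>0$, write $G_{q,r}=\{q+re^{i\theta}:\theta\in(0,\pi)\}$. For a semicircle $G_{q,r}$ passing through a point $p\in\mathcal H$, the angle $\mathrm{ang}_p(G_{q,r})\in(0,\pi)$ is the argument of $p$ around $q$, i.e. the $\theta\in(0,\pi)$ with $p=q+re^{i\theta}$. *)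

(* Defs.v *)
From HB Require Import structures.
From mathcomp Require Import all_boot all_order all_algebra.
From mathcomp Require Import finmap.
From mathcomp Require Import all_classical all_reals all_analysis.
From mathcomp Require Export complex.
Set Implicit Arguments.
Unset Strict Implicit.
Unset Printing Implicit Defensive.
Import Order.TTheory GRing.Theory Num.Theory.
Import numFieldNormedType.Exports.
Local Open Scope classical_set_scope.
Local Open Scope ring_scope.
Local Open Scope complex_scope.

Record bqf := Bqf { coefa : int; coefb : int; coefc : int }.

Definition disc (f : bqf) : int := coefb f ^+ 2 - 4 * coefa f * coefc f.

Definition normalized (f : bqf) : Prop :=
  gcdz (coefa f) (gcdz (coefb f) (coefc f)) = 1 /\
  [\/ 0 < coefa f,
      coefa f = 0 /\ 0 < coefb f
    | [/\ coefa f = 0, coefb f = 0 & 0 < coefc f]].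

Definition bqf_root (K : nzRingType) (f : bqf) (z : K) : Prop :=
  (coefa f)%:~R * z ^+ 2 + (coefb f)%:~R * z + (coefc f)%:~R = 0.

Definition upper_half_plane (R : realType) : set R[i] :=
  [set z | 0 < complex.Im z].

Definition CM_point (R : realType) (p : R[i]) : Prop :=
  upper_half_plane p /\
  exists f : bqf, [/\ normalized f, disc f < 0 & bqf_root f p].

(* q + r e^{i t} *)
Definition polar (R : realType) (q r t : R) : R[i] :=
  q%:C + r%:C * (cos t +i* sin t).

Definition semicircle (R : realType) (q r : R) : set R[i] :=
  [set polar q r t | t in `]0, pi[ ].

(* The real roots of the form are the endpoints q - r and q + r of G_{q,r}. *)
Definition RM_curve (R : realType) (D : int) (G : set R[i]) : Prop :=
  exists (f : bqf) (q r : R),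
    [/\ normalized f, 0 < disc f, coefa f != 0 & disc f = D] /\
    [/\ 0 < r, bqf_root f (q - r), bqf_root f (q + r) & G = semicircle q r].

Definition RM_through (R : realType) (p : R[i]) (Delta : R) : set (set R[i]) :=
  [set G | G p /\ exists2 D : int, RM_curve D G & D%:~R <= Delta].

(* The set below is a singleton when G is a semicircle through p. *)
Definition ang (R : realType) (p : R[i]) (G : set R[i]) : R :=
  get [set t | (t \in `]0, pi[) /\
    exists q r : R, [/\ 0 < r, G = semicircle q r & p = polar q r t]].

Definition ang_RM (R : realType) (p : R[i]) (Delta : R) : set R :=
  [set ang p G | G in RM_through p Delta].

(* fset_set sends infinite sets to fset0; only finitely many forms of bounded
   positive discriminant have a semicircle through a given CM point. *)
Definition angle_count (R : realType) (p : R[i]) (Delta : R) (I : set R) : nat :=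
  #|` fset_set (I `&` ang_RM p Delta)|%fset.

(* Main.v *)
Require Import Defs.
From HB Require Import structures.
From mathcomp Require Import all_boot all_order all_algebra.
From mathcomp Require Import finmap.
From mathcomp Require Import all_classical all_reals all_analysis.
From mathcomp Require Import complex.
From mathcomp Require Import zify ring lra.
Import Order.TTheory GRing.Theory Num.Theory.
Import numFieldNormedType.Exports.
Set Implicit Arguments.
Unset Strict Implicit.
Unset Printing Implicit Defensive.
Local Open Scope classical_set_scope.
Local Open Scope ring_scope.

(* The form [a z^2 + b z + c] has its semicircle through [p = x + i y] iff
   [a |p|^2 + b x + c = 0].  For a CM point this cuts out a rank 2 lattice in
   Z^3, on which [(a, b, c) |-> (X, Y) = (2 a x + b, 2 a y)] is an isometry:
   the discriminant is [X^2 + Y^2], and the angle of the semicircle at [p] is the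
   polar angle of [(X, Y)].  So the RM curves through [p] are the primitive
   points of a plane lattice with [Y > 0], and one has to show that these are
   equidistributed in angle.

   All lattice points: in terms of the slope [s = X / Y] the density is
   [ds / (1 + s^2)], because [X^2 + Y^2 = Y^2 (1 + s^2)] makes a sector with a
   short slope interval nearly a triangle cut off by a horizontal line, whose
   points are counted row by row.  Primitive points: if [q D] is the discrepancy
   between the primitive counts in two sectors, then the sum of [q (D / d^2)]
   over [d >= 1] is the discrepancy for all points, which is [o(D)]; as
   [\sum_(d >= 2) d^-2 < 1], this forces [q D = o(D)]. *)

(** * Cardinalities of finite sets *)

Definition ncard (T : choiceType) (A : set T) : nat := #|` fset_set A|%fset.

Section Cardinals.
Variables T U : choiceType.
Implicit Types A B : set T.

Lemma ncard_le A B : finite_set B -> A `<=` B -> (ncard A <= ncard B)%N.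
Proof.
move=> fB AB; apply: fsubset_leq_card.
by rewrite -fset_set_sub//; exact: sub_finite_set fB.
Qed.

Lemma ncardU A B : finite_set A -> finite_set B -> A `&` B = set0 ->
  ncard (A `|` B) = (ncard A + ncard B)%N.
Proof.
move=> fA fB AB0; rewrite /ncard fset_setU// cardfsU.
by rewrite -fset_setI// AB0 fset_set0 cardfs0 subn0.
Qed.

Lemma ncard_image (f : T -> U) A : finite_set A ->
  (forall x y, A x -> A y -> f x = f y -> x = y) ->
  ncard (f @` A) = ncard A.
Proof.
move=> fA finj; rewrite /ncard fset_set_image//.
apply: card_in_imfset => x y /=.
by rewrite !in_fset_set// !inE; exact: finj.
Qed.

(** Serves for two decompositions: [g] is the row index when counting lattice points, and the gcd
    when sorting them by primitivity. *)
Lemma ncard_fibers (g : T -> nat) A D : finite_set A ->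
  (forall x, A x -> (g x < D)%N) ->
  ncard A = (\sum_(d < D) ncard (A `&` [set x | g x = d]))%N.
Proof.
move=> fA gD.
(* With the condition [g x < D] built into the set, the induction on [D] runs without the hypothesis
   that bounds [g]. *)
rewrite {1}(_ : A = A `&` [set x | (g x < D)%N]); last first.
  by apply/seteqP; split => [x Ax|x []//]; split => //; exact: gD.
elim: D {gD} => [|D IH].
  rewrite big_ord0 /ncard (_ : _ `&` _ = set0) ?fset_set0 ?cardfs0//.
  by rewrite -subset0 => x [].
rewrite big_ord_recr/= -IH.
have -> : A `&` [set x | (g x < D.+1)%N] =
    (A `&` [set x | (g x < D)%N]) `|` (A `&` [set x | g x = D]).
  rewrite -setIUr; congr (_ `&` _); apply/seteqP; split => x /=.
    by rewrite ltnS leq_eqVlt => /orP[/eqP|]; [right|left].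
  by case => [|->]//; exact: ltnW.
apply: ncardU; [exact: finite_setIl|exact: finite_setIl|].
by rewrite -subset0 => x [[_ /= +] [_ /= gxD]]; rewrite gxD ltnn.
Qed.

End Cardinals.

(** * Integers in a half-open interval *)

Section IntegersInInterval.
Variable R : realType.

(** With the left end open and the right end closed, the integers run from [floor s + 1] to
    [floor t], so a difference of floors counts them exactly. *)
Lemma int_itv_image (s t : R) : s <= t ->
  [set n : int | s < n%:~R <= t] =
  (fun k : nat => Num.floor s + 1 + k%:Z) @` `I_((absz (Num.floor t - Num.floor s)%R)).
Proof.
move=> st; have fst : Num.floor s <= Num.floor t by exact: le_floor.
apply/seteqP; split => n /=.
  rewrite -floor_ge_int => /andP[sn nt].
  have sn' : Num.floor s < n by rewrite floor_lt_int.
  exists (absz (n - (Num.floor s + 1))%R) => /=;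
    move: (Num.floor s) (Num.floor t) sn' nt fst => a b; lia.
move=> [k /= kI <-]; rewrite -floor_ge_int -floor_lt_int.
by move: (Num.floor s) (Num.floor t) kI fst => a b; lia.
Qed.

Lemma finite_int_itv (s t : R) : finite_set [set n : int | s < n%:~R <= t].
Proof.
have [st|ts] := leP s t.
  by rewrite int_itv_image//; apply: finite_image; exact: finite_II.
rewrite (_ : [set _ | _] = set0)// -subset0 => n /= /andP[sn nt].
by have := lt_le_trans sn nt; rewrite ltNge (ltW ts).
Qed.

Lemma ncard_int_itv (s t : R) : s <= t ->
  t - s - 1 <= (ncard [set n : int | s < n%:~R <= t])%:R <= t - s + 1.
Proof.
move=> st; have fst : Num.floor s <= Num.floor t by exact: le_floor.
rewrite int_itv_image// ncard_image; last by move=> x y _ _ /addrI [].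
  rewrite (_ : ncard `I_ _ = (absz (Num.floor t - Num.floor s)%R)); last first.
    by apply: card_fset_set; exact: card_eqxx.
  have -> : (absz (Num.floor t - Num.floor s)%R)%:R = (Num.floor t - Num.floor s)%:~R :> R.
    rewrite -[in RHS](gez0_abs (_ : 0 <= Num.floor t - Num.floor s)) ?subr_ge0//.
  rewrite intrB; have /andP[] := floor_itv s; have /andP[] := floor_itv t.
  rewrite !intrD; lra.
exact: finite_II.
Qed.

End IntegersInInterval.

(** * Functions that are [o(D)] *)

Section Negligible.
Variable R : realType.
Implicit Types f g : R -> R.

(** This is [o(D)] plus local boundedness: the additive [C] makes the estimate valid from [D = 0]
    on, hence at every scaled argument [D / d ^+ 2]. *)
Definition negligible f := forall e, 0 < e ->
  exists C, forall D, 0 <= D -> `|f D| <= e * D + C.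

Lemma negligible_sqrt f (a b : R) :
  (forall D, 0 <= D -> `|f D| <= a * Num.sqrt D + b) -> negligible f.
Proof.
(* The constant completes the square: [e s^2 - a s + a^2 / (4 e) = e (s - a / (2 e))^2] with
   [s = sqrt D]. *)
move=> fab e e0; exists (a ^+ 2 / (4 * e) + b) => D D0.
apply: le_trans (fab D D0) _; rewrite addrA lerD2r -[in e * D](sqr_sqrtr D0).
set s := Num.sqrt D.
rewrite -subr_ge0 (_ : _ - _ = e * (s - a / (2 * e)) ^+ 2); last first.
  by field; rewrite gt_eqF.
by rewrite mulr_ge0 ?sqr_ge0// ltW.
Qed.

Lemma negligibleD f g :
  negligible f -> negligible g -> negligible (fun D => f D + g D).
Proof.
move=> nf ng e e0; have e2 : 0 < e / 2 by rewrite divr_gt0.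
have [Cf fC] := nf _ e2; have [Cg gC] := ng _ e2.
exists (Cf + Cg) => D D0; apply: le_trans (ler_normD _ _) _.
have := fC D D0; have := gC D D0; lra.
Qed.

Lemma negligibleZ (k : R) f : negligible f -> negligible (fun D => k * f D).
Proof.
move=> nf e e0; have k0 : 0 < `|k| + 1 by rewrite ltr_wpDl.
have [C fC] := nf (e / (`|k| + 1)) (divr_gt0 e0 k0).
exists (`|k| * `|C|) => D D0; rewrite normrM.
apply: le_trans (ler_wpM2l (normr_ge0 k) (fC D D0)) _; rewrite mulrDr.
apply: lerD; last by rewrite ler_wpM2l// ler_norm.
rewrite mulrA ler_wpM2r// mulrCA ger_pMr// ler_pdivrMr// mul1r.
by rewrite lerDl.
Qed.

End Negligible.

(** * Counting points of a plane lattice in the upper half plane *)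

Section LatticePoints.
Variables (R : realType) (xi w h : R).
Hypotheses (w0 : 0 < w) (h0 : 0 < h).
Implicit Types (z : nat * int) (S : set R) (s t D X Y : R).

(** The pair [(m, n)] encodes the vector [m (xi, h) + n (w, 0)]. Each row [m] is an arithmetic
    progression of step [w] at height [h * m]. *)
Definition px z : R := xi * z.1%:R + w * z.2%:~R.
Definition py z : R := h * z.1%:R.
(** The cotangent of the polar angle, finite on the whole open upper half plane. *)
Definition slope z : R := px z / py z.
Definition sqnorm z : R := px z ^+ 2 + py z ^+ 2.

Definition points D S : set (nat * int) :=
  [set z | [/\ (0 < z.1)%N, sqnorm z <= D & S (slope z)]].
Definition box Y X : set (nat * int) :=
  [set z | [/\ (0 < z.1)%N, py z <= Y & `|px z| <= X]].
Definition cone s t Y : set (nat * int) :=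
  [set z | [/\ (0 < z.1)%N, py z <= Y & s < slope z <= t]].

(* [kappa * (t - s)] is the area of [{s < x / y <= t, 0 < y <= 1}] divided by
   the covolume [h * w]. *)
Definition kappa : R := (2 * h * w)^-1.

Lemma kappa_gt0 : 0 < kappa.
Proof. by rewrite invr_gt0 !mulr_gt0. Qed.

Lemma py_gt0 z : (0 < z.1)%N -> 0 < py z.
Proof. by move=> z0; rewrite mulr_gt0// ltr0n. Qed.

Lemma py_le_row z Y : 0 <= Y -> py z <= Y -> (z.1 < (Num.truncn (Y / h)).+1)%N.
Proof.
move=> Y0 zY; rewrite ltnS truncn_ge_nat ?divr_ge0 ?(ltW h0)//.
by rewrite ler_pdivlMr// mulrC.
Qed.

Lemma finite_box Y X : 0 <= Y -> finite_set (box Y X).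
Proof.
move=> Y0; set M := (Num.truncn (Y / h)).+1.
(* [w * n = px z - xi * m] bounds [|n|] by [K]; the interval below starts at [- K - 1] because its
   left end is open. *)
set K := (X + `|xi| * M%:R) / w.
apply: (@sub_finite_set _ _ (`I_M `*` [set n : int | - K - 1 < n%:~R <= K])).
  move=> z [z0 zY zX]; have zM := py_le_row Y0 zY; split => //=.
  have : `|z.2%:~R| <= K.
    rewrite ler_pdivlMr// -[w in X in X <= _](gtr0_norm w0) -normrM mulrC.
    rewrite (_ : w * _ = px z - xi * z.1%:R); last by rewrite /px; ring.
    apply: le_trans (ler_normB _ _) _; rewrite lerD// normrM ler_wpM2l//.
    by rewrite normr_nat ler_nat ltnW.
  rewrite ler_norml; lra.
by apply: finite_setX; [exact: finite_II|exact: finite_int_itv].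
Qed.

Lemma cone_sub_box s t Y : 0 <= Y ->
  cone s t Y `<=` box Y ((`|s| + `|t|) * Y).
Proof.
move=> Y0 z [z0 zY /andP[sz zt]]; split => //.
have pz := py_gt0 z0; rewrite -[px z](divfK (lt0r_neq0 pz)) normrM (gtr0_norm pz).
apply: ler_pM => //; first exact: ltW.
rewrite -/(slope z) ler_norml.
have := ler_norm t; have := ler_norm (- s); rewrite normrN.
have := normr_ge0 s; have := normr_ge0 t; lra.
Qed.

Lemma points_sub_box D S : 0 <= D ->
  points D S `<=` box (Num.sqrt D) (Num.sqrt D).
Proof.
move=> D0 z [z0 zD _]; have pz := py_gt0 z0; split => //.
  rewrite -[py z](gtr0_norm pz) -sqrtr_sqr ler_wsqrtr//.
  by apply: le_trans zD; rewrite lerDr sqr_ge0.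
rewrite -sqrtr_sqr ler_wsqrtr//.
by apply: le_trans zD; rewrite lerDl sqr_ge0.
Qed.

Lemma finite_points D S : 0 <= D -> finite_set (points D S).
Proof.
move=> D0; apply: sub_finite_set (points_sub_box (S:=S) D0) _.
by apply: finite_box; exact: sqrtr_ge0.
Qed.

Lemma ncard_row (A : set (nat * int)) (d : nat) :
  ncard (A `&` [set z | z.1 = d]) = ncard [set n : int | A (d, n)].
Proof.
have [fA|iA] := pselect (finite_set [set n : int | A (d, n)]).
  rewrite -(ncard_image (f := fun n : int => (d, n)) fA)//; last by move=> ? ? _ _ [].
  congr ncard; apply/seteqP; split => [[m n] [/= Az <-]|z [n /= An <-]//].
  by exists n.
(* An infinite row makes both sides 0, the value of [ncard] on infinite sets. *)
rewrite /ncard /fset_set; case: pselect => [|_]; last by case: pselect.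
move=> fA; exfalso; apply: iA.
apply: (sub_finite_set (_ : _ `<=` snd @` (A `&` [set z | z.1 = d]))).
  by move=> n /= An; exists (d, n).
exact: finite_image.
Qed.

Lemma ncard_box Y X : 0 <= Y -> 0 <= X ->
  (ncard (box Y X))%:R <= Y / h * (2 * X / w + 2).
Proof.
move=> Y0 X0; rewrite (@ncard_fibers _ (fun z => z.1) _ (Num.truncn (Y / h)).+1).
- rewrite big_ord_recl /= ncard_row (_ : [set n | _] = set0); last first.
    by rewrite -subset0 => n [].
  rewrite /ncard fset_set0 cardfs0 add0n natr_sum.
  set B : R := _ + 2; have B0 : 0 <= B by rewrite addr_ge0// !mulr_ge0// ltW// invr_gt0.
  apply: (@le_trans _ _ (\sum_(i < Num.truncn (Y / h)) B)).
    apply: ler_sum => d _; rewrite -/(ncard _) ncard_row.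
    set m := bump 0 d; set c := xi * m%:R.
    (* The closed condition [|px z| <= X] fits a half-open interval once the left end is lowered by
       1; this and the error 1 of [ncard_int_itv] make up the 2 in the bound. *)
    have le_st : - (X + c) / w - 1 <= (X - c) / w.
      rewrite -subr_ge0 (_ : _ - _ = 2 * X / w + 1); last by field; rewrite gt_eqF.
      by rewrite addr_ge0// !mulr_ge0// ltW// invr_gt0.
    have /andP[_] := ncard_int_itv le_st.
    rewrite (_ : _ - _ + 1 = B); last by rewrite /B; field; rewrite gt_eqF.
    apply: le_trans; rewrite ler_nat; apply: ncard_le; first exact: finite_int_itv.
    move=> n [_ _]; rewrite /px/= -/c ler_norml => /andP[n1 n2].
    rewrite ler_pdivlMr// ltrBlDr ltr_pdivrMr//.
    by have w1 := w0; apply/andP; split; lra.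
  rewrite big_const_ord iter_addr_0 -[leLHS]mulr_natl ler_wpM2r//.
  by rewrite truncn_le divr_ge0// ltW.
- exact: finite_box.
- by move=> z [_ zY _]; exact: py_le_row.
Qed.

(** Row [d] meets the cone in an interval containing [tau * d] lattice points up to an error of 1.
    Summing over the rows gives the area term, with an error of the order of the number of rows. *)
Lemma ncard_cone s t : s <= t ->
  exists A, forall Y, 0 <= Y ->
  `|(ncard (cone s t Y))%:R - kappa * (t - s) * Y ^+ 2| <= A * (Y / h + 1).
Proof.
move=> st; set tau := (t - s) * h / w.
have tau0 : 0 <= tau by rewrite !mulr_ge0 ?subr_ge0// ltW// invr_gt0.
(* The 1 pays for rounding in each row, [tau / 2] for replacing [M * (M + 1)] by [(Y / h) ^+ 2]. *)
exists (1 + tau / 2) => Y Y0.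
set M := Num.truncn (Y / h).
have Yh0 : 0 <= Y / h by rewrite divr_ge0// ltW.
have /andP[MY YM] : M%:R <= Y / h < M.+1%:R by exact: truncn_itv.
have fcone : finite_set (cone s t Y).
  exact: sub_finite_set (cone_sub_box Y0) (finite_box _ Y0).
rewrite (@ncard_fibers _ (fun z => z.1) _ M.+1) //; last first.
  by move=> z [_ zY _]; exact: py_le_row.
have rowP (d : 'I_M.+1) :
    `|(ncard (cone s t Y `&` [set z | z.1 = d :> nat]))%:R - tau * d%:R| <= 1.
  rewrite ncard_row; have [d0|d0] := posnP (nat_of_ord d).
    rewrite (_ : [set n | _] = set0); last by rewrite -subset0 => n []; rewrite d0.
    by rewrite /ncard fset_set0 cardfs0 d0 mulr0 subrr normr0.
  have dR : 0 < d%:R :> R by rewrite ltr0n.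
  pose a u : R := (u * h - xi) * d%:R / w.
  have -> : [set n : int | cone s t Y (nat_of_ord d, n)] =
            [set n : int | a s < n%:~R <= a t].
    have hd : 0 < h * d%:R by rewrite mulr_gt0.
    have dY : h * d%:R <= Y.
      rewrite mulrC -ler_pdivlMr//; apply: le_trans MY.
      by rewrite ler_nat -ltnS.
    apply/seteqP; split => n /=; rewrite /cone/= /slope /px /py /a /=;
      rewrite ltr_pdivlMr// ler_pdivrMr// ltr_pdivrMr// ler_pdivlMr//.
      move=> [_ _ /andP[n1 n2]]; apply/andP; split; lra.
    move=> /andP[n1 n2]; split => //; apply/andP; split; lra.
  have ast : a s <= a t.
    rewrite /a !ler_wpM2r ?(ltW dR) ?invr_ge0 ?(ltW w0)//.
    by rewrite lerD2r ler_wpM2r// ltW.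
  have := ncard_int_itv ast.
  rewrite (_ : a t - a s = tau * d%:R); last by rewrite /a /tau; field; rewrite gt_eqF.
  rewrite ler_norml; lra.
have -> : kappa * (t - s) * Y ^+ 2 = tau / 2 * (Y / h) ^+ 2.
  by rewrite /kappa /tau; field; rewrite !gt_eqF.
have sumd : \sum_(d < M.+1) d%:R = M%:R * M.+1%:R / 2 :> R.
  elim: (M) => [|k IH]; first by rewrite big_ord1 mul0r mul0r.
  by rewrite big_ord_recr/= IH -!natr1; field.
have S1 : `|(\sum_(d < M.+1) ncard (cone s t Y `&` [set z | z.1 = d :> nat]))%N%:R -
    tau * (M%:R * M.+1%:R / 2)| <= M.+1%:R.
  rewrite -sumd natr_sum mulr_sumr -sumrB.
  apply: le_trans (ler_norm_sum _ _ _) _.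
  apply: (@le_trans _ _ (\sum_(d < M.+1) 1)); first by apply: ler_sum => d _; exact: rowP.
  by rewrite sumr_const card_ord.
have t2 : 0 <= tau / 2 by rewrite divr_ge0.
have S2 : `|tau * (M%:R * M.+1%:R / 2) - tau / 2 * (Y / h) ^+ 2| <= tau / 2 * M.+1%:R.
  have -> : forall a b, tau * (a / 2) - tau / 2 * b = tau / 2 * (a - b).
    by move=> a b; field.
  rewrite normrM (ger0_norm t2) ler_wpM2l//.
  have M0 : 0 <= M%:R :> R by [].
  move: MY YM; rewrite -natr1 => MY YM.
  rewrite ler_norml; apply/andP; split; nra.
apply: le_trans (ler_distD (tau * (M%:R * M.+1%:R / 2)) _ _) _.
apply: le_trans (lerD S1 S2) _; rewrite -{1}[M.+1%:R]mul1r -mulrDl.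
rewrite ler_wpM2l ?(addr_ge0 _ t2)//.
by rewrite -natr1 lerD2r.
Qed.

(** * Points in a sector of a disc *)

Definition halfopen s t : set R := [set u | s < u <= t].

Lemma sqnormE z : (0 < z.1)%N -> sqnorm z = py z ^+ 2 * (1 + slope z ^+ 2).
Proof.
move=> z0; rewrite /sqnorm /slope.
by field; rewrite lt0r_neq0// py_gt0.
Qed.

(** Makes the density [1 / (1 + s ^+ 2)] nearly constant on a short slope interval. *)
Lemma inv1sq_lipschitz s t :
  `|(1 + s ^+ 2)^-1 - (1 + t ^+ 2)^-1| <= `|s - t|.
Proof.
have s1 : 0 < 1 + s ^+ 2 by rewrite ltr_pwDl// sqr_ge0.
have t1 : 0 < 1 + t ^+ 2 by rewrite ltr_pwDl// sqr_ge0.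
have -> : (1 + s ^+ 2)^-1 - (1 + t ^+ 2)^-1 =
    (t - s) * ((s + t) / ((1 + s ^+ 2) * (1 + t ^+ 2))).
  by field; rewrite !lt0r_neq0.
rewrite normrM distrC ler_piMr//.
rewrite normrM normfV (gtr0_norm (mulr_gt0 s1 t1)) ler_pdivrMr ?mulr_gt0//.
(* The quotient is at most 1 in absolute value: the squares give [|s + t| <= 1 + s^2 + t^2], which
   the denominator dominates. *)
have sq0 := sqr_ge0 (s * t); have := sqr_ge0 (s - 1); have := sqr_ge0 (s + 1).
have := sqr_ge0 (t - 1); have := sqr_ge0 (t + 1).
rewrite mul1r ler_norml => *; apply/andP; split; nra.
Qed.

Lemma atan_mvt s t : s <= t ->
  exists2 c, s <= c <= t & atan t - atan s = (1 + c ^+ 2)^-1 * (t - s).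
Proof.
move=> st.
have [|c cst ->] := @MVT_segment R atan (fun x => (1 + x ^+ 2)^-1) s t st.
- by apply: continuous_subspaceT => y; exact: continuous_atan.
- by exists c => //; rewrite in_itv in cst.
Qed.

(** The sector lies between two triangles [cone s t Y], with [Y ^+ 2] equal to [D * lo] and
    [D * hi], where [lo] and [hi] bound [1 / (1 + u ^+ 2)] for the slopes [u] of the interval. *)
Lemma points_halfopen_short e s t : 0 < e -> s <= t -> t - s <= e ->
  exists a b, forall D, 0 <= D ->
  `|(ncard (points D (halfopen s t)))%:R - kappa * (atan t - atan s) * D|
    <= 2 * kappa * e * (t - s) * D + a * Num.sqrt D + b.
Proof.
move=> e0 st te; have [A coneA] := ncard_cone st.
have [c /andP[sc ct] ->] := atan_mvt st.
have near (u : R) : s <= u <= t -> `|(1 + u ^+ 2)^-1 - (1 + s ^+ 2)^-1| <= e.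
  move=> /andP[su ut]; apply: le_trans (inv1sq_lipschitz _ _) _.
  rewrite ger0_norm ?subr_ge0//; lra.
have pos (u : R) : 0 < (1 + u ^+ 2)^-1 by rewrite invr_gt0 ltr_pwDl// sqr_ge0.
set c0 := (1 + s ^+ 2)^-1 in near *; have c00 : 0 < c0 by exact: pos.
set cc := (1 + c ^+ 2)^-1.
have cc0 : `|cc - c0| <= e by apply: near; rewrite sc ct.
(* [c0 - e] may be negative; the maximum keeps [D * lo] the square of a real height. *)
pose hi := c0 + e; pose lo := Num.max (c0 - e) 0.
have hi0 : 0 <= hi by rewrite addr_ge0// ltW.
have lo0 : 0 <= lo by rewrite le_max lexx orbT.
have ylo (u : R) D : 0 <= D -> s < u <= t -> D * lo <= D * (1 + u ^+ 2)^-1 <= D * hi.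
  move=> D0 /andP[su ut].
  have := near u; rewrite (ltW su) ut => /(_ isT); rewrite ler_norml => nu.
  rewrite !ler_wpM2l//; first by rewrite /hi; lra.
  by rewrite ge_max (ltW (pos u)) andbT; lra.
exists (`|A| * (Num.sqrt hi + Num.sqrt lo) / h), `|A| => D D0.
have fin Y : 0 <= Y -> finite_set (cone s t Y).
  by move=> Y0; exact: sub_finite_set (cone_sub_box Y0) (finite_box _ Y0).
have sqE (b : R) : 0 <= b -> Num.sqrt (D * b) ^+ 2 = D * b.
  by move=> b0; rewrite sqr_sqrtr// mulr_ge0.
have upper : (ncard (points D (halfopen s t)) <= ncard (cone s t (Num.sqrt (D * hi))))%N.
  apply: ncard_le; first by apply: fin; exact: sqrtr_ge0.
  move=> z [z0 zD zst]; split => //.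
  have pz := py_gt0 z0; rewrite -[py z](gtr0_norm pz) -sqrtr_sqr ler_wsqrtr//.
  have /andP[_] := ylo _ _ D0 zst; apply: le_trans.
  rewrite ler_pdivlMr; last by rewrite ltr_pwDl// sqr_ge0.
  by rewrite -sqnormE.
have lower : (ncard (cone s t (Num.sqrt (D * lo))) <= ncard (points D (halfopen s t)))%N.
  apply: ncard_le; first exact: finite_points.
  move=> z [z0 zD zst]; split => //.
  have pz := py_gt0 z0; rewrite sqnormE// -ler_pdivlMr; last by rewrite ltr_pwDl// sqr_ge0.
  have /andP[+ _] := ylo _ _ D0 zst; apply: le_trans.
  by rewrite -[D * lo]sqE// ler_pXn2r ?nnegrE ?sqrtr_ge0// ltW.
have cone_bound (b : R) : 0 <= b ->
    `|(ncard (cone s t (Num.sqrt (D * b))))%:R - kappa * (t - s) * (D * b)|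
    <= `|A| * Num.sqrt b / h * Num.sqrt D + `|A|.
  move=> b0; have := coneA _ (sqrtr_ge0 (D * b)); rewrite sqE// => /le_trans; apply.
  rewrite sqrtrM// (_ : _ + `|A| = `|A| * (Num.sqrt D * Num.sqrt b / h + 1)); last first.
    by field; exact: lt0r_neq0.
  rewrite ler_wpM2r ?ler_norm// addr_ge0// !mulr_ge0 ?sqrtr_ge0// invr_ge0.
  exact: ltW.
have kap : 0 <= kappa * (t - s) * D.
  by rewrite !mulr_ge0 ?subr_ge0// ltW// kappa_gt0.
set n := ncard (points D _); have := cone_bound _ hi0; have := cone_bound _ lo0.
rewrite -(ler_nat R) in upper; rewrite -(ler_nat R) in lower.
move: upper lower; set n1 : R := _%:R => upper; set n2 : R := _%:R => lower.
have sn (b : R) : 0 <= `|A| * Num.sqrt b / h * Num.sqrt D.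
  by rewrite !mulr_ge0 ?sqrtr_ge0// invr_ge0 ltW.
rewrite !ler_norml => /andP[L1 L2] /andP[L3 L4].
rewrite ler_norml in cc0; case/andP: cc0 => cc1 cc2.
have lolo : c0 - e <= lo by rewrite le_max lexx.
(* Passing from [c0] to the mean value [cc] costs a second [e], whence the factor 2 in the error
   term. *)
have hihi : hi <= cc + 2 * e by rewrite /hi; lra.
have {}lolo : cc - 2 * e <= lo by lra.
have H1 := ler_wpM2l kap hihi; have H2 := ler_wpM2l kap lolo.
have shi := sn hi; have slo := sn lo.
rewrite (_ : `|A| * (Num.sqrt hi + Num.sqrt lo) / h * Num.sqrt D =
  `|A| * Num.sqrt hi / h * Num.sqrt D + `|A| * Num.sqrt lo / h * Num.sqrt D);
  last by ring.
move: L1 L2 L3 L4 shi slo; set x := _ / h * Num.sqrt D.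
set y := _ / h * Num.sqrt D => L1 L2 L3 L4 shi slo.
apply/andP; split; lra.
Qed.

Lemma points_halfopenD D s t u : 0 <= D -> s <= t -> t <= u ->
  ncard (points D (halfopen s u)) =
  (ncard (points D (halfopen s t)) + ncard (points D (halfopen t u)))%N.
Proof.
move=> D0 st tu; rewrite -ncardU; [|exact: finite_points..|].
  congr ncard; apply/seteqP; split => z.
    move=> [z0 zD /andP[sz zu]]; have [zt|tz] := leP (slope z) t; [left|right].
      by split => //; apply/andP.
    by split => //; apply/andP.
  move=> [] [z0 zD /andP[sz zu]]; split => //; apply/andP; split => //.
    exact: le_trans zu tu.
  exact: le_lt_trans st sz.
rewrite -subset0 => z [[_ _ /andP[_ zt]] [_ _ /andP[tz _]]].
by have := lt_le_trans tz zt; rewrite ltxx.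
Qed.

(** Bisecting [k] times reaches short intervals. The linear error is proportional to [t - s], so it
    adds up over the pieces without growing. *)
Lemma points_halfopen_dyadic e (k : nat) s t : 0 < e -> s <= t -> t - s <= e * 2 ^+ k ->
  exists a b, forall D, 0 <= D ->
  `|(ncard (points D (halfopen s t)))%:R - kappa * (atan t - atan s) * D|
    <= 2 * kappa * e * (t - s) * D + a * Num.sqrt D + b.
Proof.
move=> e0; elim: k s t => [|k IH] s t st.
  by rewrite expr0 mulr1; exact: points_halfopen_short.
rewrite exprS => ste; pose m := (s + t) / 2.
have sm : s <= m by rewrite /m; lra.
have mt : m <= t by rewrite /m; lra.
have [|a1 [b1 H1]] := IH s m sm; first by rewrite /m; lra.
have [|a2 [b2 H2]] := IH m t mt; first by rewrite /m; lra.
exists (a1 + a2), (b1 + b2) => D D0.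
rewrite (points_halfopenD D0 sm mt) natrD.
have := lerD (H1 D D0) (H2 D D0); move/(le_trans (ler_normD _ _)).
rewrite (_ : _ - _ + (_ - _) = (ncard (points D (halfopen s m)))%:R +
  (ncard (points D (halfopen m t)))%:R - kappa * (atan t - atan s) * D); last by ring.
move/le_trans; apply; rewrite le_eqVlt; apply/orP; left; apply/eqP; ring.
Qed.

Lemma points_halfopen s t : s <= t ->
  negligible (fun D => (ncard (points D (halfopen s t)))%:R
                       - kappa * (atan t - atan s) * D).
Proof.
move=> st d d0; have k0 := kappa_gt0.
(* With [e = d / L] the linear error is at most [d / 2]; the added 1 keeps [L] positive when
   [s = t]. *)
set L := 4 * kappa * (t - s) + 1.
have L0 : 0 < L by rewrite ltr_wpDl// !mulr_ge0 ?subr_ge0// ltW.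
set e := d / L; have e0 : 0 < e by rewrite divr_gt0.
have [k ke] : exists k : nat, (t - s) / e <= 2 ^+ k.
  exists (Num.truncn ((t - s) / e)).+1; apply: ltW.
  apply: lt_le_trans (truncnS_gt _) _.
  by rewrite -natrX ler_nat ltnW// ltn_expl.
rewrite ler_pdivrMr// mulrC in ke.
have [a [b H]] := points_halfopen_dyadic e0 st ke.
have d2 : 0 < d / 2 by rewrite divr_gt0.
have [|C HC] := @negligible_sqrt R (fun D => a * Num.sqrt D + b) `|a| `|b| _ _ d2.
  move=> D D0; apply: le_trans (ler_normD _ _) _.
  by rewrite normrM (ger0_norm (sqrtr_ge0 _)).
exists C => D D0; apply: le_trans (H D D0) _.
have := HC D D0; have := ler_norm (a * Num.sqrt D + b).
have : 2 * kappa * e * (t - s) * D <= d / 2 * D.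
  rewrite ler_wpM2r//.
  have -> : 2 * kappa * e * (t - s) = (L - 1) / L * (d / 2).
    by rewrite /e /L; field; rewrite -/L lt0r_neq0.
  by rewrite ger_pMl ?divr_gt0// ler_pdivrMr// mul1r gerBl.
lra.
Qed.

(** Describing slopes through [atan] lets the ends reach [pi / 2] and [- (pi / 2)], where the slope
    is unbounded. *)
Definition atan_between (alpha beta : R) : set R :=
  [set u | alpha <= atan u <= beta].

Lemma ltr_atan s t : s < t -> atan s < atan t.
Proof.
move=> st; have [c _ act] := atan_mvt (ltW st).
by rewrite -subr_gt0 act mulr_gt0 ?subr_gt0// invr_gt0 ltr_pwDl// sqr_ge0.
Qed.

(** Trimming the angle interval by [eta] at both ends keeps it inside the domain where [tan] is
    finite, so [points_halfopen] applies to the trimmed sector. *)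
Lemma points_ge (alpha beta : R) S :
  - (pi / 2) <= alpha -> alpha <= beta -> beta <= pi / 2 ->
  (forall u, alpha < atan u < beta -> S u) ->
  forall e, 0 < e -> exists C, forall D, 0 <= D ->
    kappa * (beta - alpha) * D - e * D - C <= (ncard (points D S))%:R.
Proof.
move=> alo ab bhi subS e e0; have k0 := kappa_gt0.
(* For a narrow interval the claimed lower bound is nonpositive up to its constant. *)
have [small|big] := leP (kappa * (beta - alpha)) e.
  exists 0 => D D0; apply: (@le_trans _ _ 0) => //.
  by rewrite subr0 -mulrBl mulr_le0_ge0// subr_le0.
(* Trimming costs [2 * kappa * eta = e / 2]; the other half of [e] is left for the counting
   error. *)
pose eta := e / (4 * kappa); have eta0 : 0 < eta by rewrite divr_gt0// mulr_gt0.
have keta : kappa * eta = e / 4 by rewrite /eta; field; exact: lt0r_neq0.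
have wide : 4 * eta < beta - alpha by rewrite -(ltr_pM2l k0) mulrCA keta; lra.
have inI x : alpha < x < beta -> atan (tan x) = x.
  by move=> /andP[? ?]; rewrite tanK// in_itv/=; apply/andP; split; lra.
have aK : atan (tan (alpha + eta)) = alpha + eta.
  by apply: inI; apply/andP; split; lra.
have bK : atan (tan (beta - eta)) = beta - eta.
  by apply: inI; apply/andP; split; lra.
set s := tan (alpha + eta) in aK; set t := tan (beta - eta) in bK.
have st : s <= t.
  rewrite leNgt; apply/negP => /ltr_atan; rewrite aK bK; lra.
have [|C HC] := points_halfopen st (e := e / 2); first by rewrite divr_gt0.
exists C => D D0; have := HC D D0; rewrite aK bK ler_norml => /andP[+ _].
have le_n : (ncard (points D (halfopen s t)))%:R <= (ncard (points D S))%:R :> R.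
  rewrite ler_nat; apply: ncard_le; first exact: finite_points.
  move=> z [z0 zD /andP[sz zt]]; split => //; apply: subS; apply/andP; split.
    by have := ltr_atan sz; rewrite aK; lra.
  rewrite ltNge; apply/negP => bz.
  move: zt; rewrite le_eqVlt => /orP[/eqP zt|/ltr_atan]; last by rewrite bK; lra.
  by move: bz; rewrite zt bK; lra.
rewrite (_ : kappa * (beta - eta - (alpha + eta)) * D =
  kappa * (beta - alpha) * D - 2 * (kappa * eta) * D); last by ring.
rewrite keta; lra.
Qed.

Lemma points_total_le e : 0 < e -> exists C, forall D, 0 <= D ->
  (ncard (points D setT))%:R <= kappa * pi * D + e * D + C.
Proof.
move=> e0; have k0 := kappa_gt0.
(* Points with a slope beyond [sigma] in absolute value lie in a flat box of height
   [sqrt D / sigma]; this [sigma] makes the main term of its count [e / 4 * D]. *)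
pose sigma := 16 * kappa / e; have s0 : 0 < sigma by rewrite divr_gt0// mulr_gt0.
have ss : - sigma <= sigma by lra.
have e4 : 0 < e / 4 by rewrite divr_gt0.
have [C1 H1] := points_halfopen ss e4.
have [|C2 H2] := @negligible_sqrt R (fun D => 2 / (sigma * h) * Num.sqrt D)
    (2 / (sigma * h)) 0 _ _ e4.
  move=> D D0; rewrite addr0 ger0_norm//.
  by rewrite mulr_ge0 ?sqrtr_ge0// divr_ge0// mulr_ge0// ltW.
exists (C1 + C2) => D D0.
have sD := sqrtr_ge0 D; have y0 : 0 <= Num.sqrt D / sigma by rewrite divr_ge0// ltW.
have cover : (ncard (points D setT) <= ncard (points D (halfopen (- sigma) sigma))
    + ncard (box (Num.sqrt D / sigma) (Num.sqrt D)))%N.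
  apply: leq_trans (_ : ncard (points D (halfopen (- sigma) sigma) `|`
    box (Num.sqrt D / sigma) (Num.sqrt D)) <= _)%N.
    apply: ncard_le.
      by rewrite finite_setU; split; [exact: finite_points|exact: finite_box].
    move=> z Pz; have [z0 zD _] := Pz.
    have [_ _ zx] := points_sub_box D0 Pz; have pz := py_gt0 z0.
    have [small|big] := boolP (- sigma < slope z <= sigma); [by left|right].
    split => //; rewrite ler_pdivlMr// mulrC; apply: le_trans zx.
    rewrite -[px z](divfK (lt0r_neq0 pz)) normrM (gtr0_norm pz) ler_wpM2r ?(ltW pz)//.
    rewrite -/(slope z); move: big; rewrite negb_and -leNgt -ltNge => /orP[|/ltW] sz.
      by rewrite -normrN; apply: le_trans (ler_norm _); rewrite lerNr.
    exact: le_trans (ler_norm _).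
  rewrite /ncard fset_setU; [|exact: finite_points|exact: finite_box].
  by rewrite cardfsU leq_subr.
rewrite -(ler_nat R) natrD in cover.
have := ncard_box y0 sD; have := H1 D D0; have := H2 D D0.
have -> : Num.sqrt D / sigma / h * (2 * Num.sqrt D / w + 2) =
    e / 4 * D + 2 / (sigma * h) * Num.sqrt D.
  rewrite -[X in e / 4 * X](sqr_sqrtr D0) /sigma /kappa.
  by field; rewrite !lt0r_neq0.
rewrite atanN opprK.
have : kappa * (atan sigma + atan sigma) * D <= kappa * pi * D.
  rewrite ler_wpM2r// ler_wpM2l// ?(ltW k0)//.
  have := atan_ltpi2 sigma; lra.
have eD0 := mulr_ge0 (ltW e0) D0.
rewrite !ler_norml => ? /andP[_ ?] /andP[_ ?] ?; lra.
Qed.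

(** The upper bound comes from the complement: subtract from the total count the lower bounds for
    the sectors on either side. Steep and flat directions thus need no separate estimate. *)
Lemma points_atan_between (alpha beta : R) :
  - (pi / 2) <= alpha -> alpha <= beta -> beta <= pi / 2 ->
  negligible (fun D => (ncard (points D (atan_between alpha beta)))%:R
                       - kappa * (beta - alpha) * D).
Proof.
move=> alo ab bhi e e0; have e3 : 0 < e / 3 by rewrite divr_gt0.
pose below := [set u : R | atan u < alpha].
pose above := [set u : R | beta < atan u].
have [C1 H1] : exists C, forall D, 0 <= D ->
    kappa * (alpha - - (pi / 2)) * D - e / 3 * D - C <= (ncard (points D below))%:R.
  by apply: points_ge => //; [exact: le_trans bhi|move=> u /andP[]].
have [C2 H2] : exists C, forall D, 0 <= D ->
    kappa * (pi / 2 - beta) * D - e / 3 * D - C <= (ncard (points D above))%:R.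
  by apply: points_ge => //; [exact: le_trans ab|move=> u /andP[]].
have [C3 H3] := points_total_le e3.
have [|C H] := points_ge alo ab bhi (S := atan_between alpha beta) _ e0.
  by move=> u /andP[u1 u2]; rewrite /atan_between/= !ltW.
exists (`|C| + `|C1| + `|C2| + `|C3|) => D D0.
have part : (ncard (points D (atan_between alpha beta)) + ncard (points D below)
    + ncard (points D above) <= ncard (points D setT))%N.
  rewrite -!ncardU.
  - apply: ncard_le; first exact: finite_points.
    by move=> z [[[]|[]]|[]].
  - by rewrite finite_setU; split; exact: finite_points.
  - exact: finite_points.
  - rewrite -subset0 => z [[[_ _ /andP[az zb]]|[_ _ zlo]] [_ _ zhi]].
      by have := lt_le_trans zhi zb; rewrite ltxx.
    by have := lt_trans zhi zlo; rewrite ltNge ab.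
  - exact: finite_points.
  - exact: finite_points.
  - rewrite -subset0 => z [[_ _ /andP[az _]] [_ _ za]].
    by have := lt_le_trans za az; rewrite ltxx.
rewrite -(ler_nat R) !natrD in part.
have := H D D0; have := H1 D D0; have := H2 D D0; have := H3 D D0.
have := ler_norm C; have := ler_norm C1; have := ler_norm C2; have := ler_norm C3.
have := normr_ge0 C; have := normr_ge0 C1; have := normr_ge0 C2; have := normr_ge0 C3.
rewrite ler_norml => *; apply/andP; split; lra.
Qed.

End LatticePoints.

(** * From all points to primitive points by contraction *)

Section Contraction.
Variables (R : realType) (h : R).
Hypothesis h0 : 0 < h.
Implicit Types (q : R -> R) (D : R).

(** The terms [d >= 2] of the sum of [q (D / d ^+ 2)], with [d = i.+2]. The cut-off suits point
    counts: the gcd of a lattice point divides its row index, which is at most [sqrt D / h]. *)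
Definition tail_sum q D : R :=
  \sum_(i < Num.truncn (Num.sqrt D / h)) q (D / i.+2%:R ^+ 2).

(** Telescoping [1 / d^2 <= 1 / (d - 1) - 1 / d] from [d = 3] on, after the first term
    [1 / 4 = 3 / 4 - 1 / 2]. *)
Lemma sum_invsq_le (M : nat) : \sum_(i < M) (i.+2%:R ^+ 2)^-1 <= 3 / 4 :> R.
Proof.
suff H (k : nat) : \sum_(i < k.+1) (i.+2%:R ^+ 2)^-1 <= 3 / 4 - k.+2%:R^-1 :> R.
  case: M => [|k]; first by rewrite big_ord0 divr_ge0.
  by apply: le_trans (H k) _; rewrite gerBl invr_ge0.
elim: k => [|k IH].
  by rewrite big_ord1 /= (_ : 3 / 4 - _ = (2 ^+ 2)^-1)//; field.
rewrite big_ord_recr/=; apply: le_trans (lerD IH (lexx _)) _.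
have k0 : 0 <= k%:R :> R by [].
have -> : k.+3%:R = k%:R + 3 :> R by rewrite -addn3 natrD.
have -> : k.+2%:R = k%:R + 2 :> R by rewrite -addn2 natrD.
rewrite -subr_ge0.
have -> : 3 / 4 - (k%:R + 3)^-1 - (3 / 4 - (k%:R + 2)^-1 + ((k%:R + 3) ^+ 2)^-1) =
    ((k%:R + 2) * (k%:R + 3) ^+ 2)^-1 :> R.
  by field; rewrite !lt0r_neq0//; lra.
by rewrite invr_ge0 mulr_ge0 ?sqr_ge0//; lra.
Qed.

(** The linear part shrinks by the factor [3 / 4], while the constant is counted at most
    [sqrt D / h] times and so stays of lower order. *)
Lemma tail_sum_le q (rho C : R) : 0 <= rho -> 0 <= C ->
  (forall D, 0 <= D -> q D <= rho * D + C) ->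
  forall D, 0 <= D -> tail_sum q D <= 3 / 4 * rho * D + C / h * Num.sqrt D.
Proof.
move=> rho0 C0 qC D D0; rewrite /tail_sum; set M := Num.truncn _.
apply: (@le_trans _ _ (\sum_(i < M) (rho * D * (i.+2%:R ^+ 2)^-1 + C))).
  apply: ler_sum => i _; rewrite -[rho * D * _]mulrA; apply: qC.
  by rewrite divr_ge0// exprn_ge0.
rewrite big_split/= -mulr_sumr; apply: lerD.
  by rewrite mulrC -[leRHS]mulrA ler_wpM2r ?mulr_ge0// sum_invsq_le.
rewrite sumr_const card_ord -mulr_natr mulrAC -mulrA ler_wpM2l//.
by rewrite truncn_le divr_ge0 ?sqrtr_ge0// ltW.
Qed.

(* Since [\sum_(d >= 2) d ^- 2 <= 3 / 4 < 1], the relation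
   [E D = \sum_(d >= 1) q (D / d ^+ 2)] improves any linear bound on [q] by a
   constant factor, so no Moebius inversion is needed. *)
Lemma negligible_of_tail_sum q (K : R) :
  (forall D, 0 <= D -> `|q D| <= K * D + K) ->
  negligible (fun D => q D + tail_sum q D) -> negligible q.
Proof.
move=> qK nE.
pose bounded rho := exists C, forall D, 0 <= D -> `|q D| <= rho * D + C.
(* [7 / 8 = 3 / 4 + 1 / 16 + 1 / 16]: the tail, the negligible sum and the square-root term. *)
have step rho : 0 < rho -> bounded rho -> bounded (7 / 8 * rho).
  move=> rho0 [C0 HC0]; pose C := `|C0|.
  have HC D : 0 <= D -> `|q D| <= rho * D + C.
    by move=> D0; apply: le_trans (HC0 D D0) _; rewrite lerD2l ler_norm.
  have r16 : 0 < rho / 16 by rewrite divr_gt0.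
  have [C1 H1] := nE _ r16.
  have [|C2 H2] := @negligible_sqrt R (fun D => C / h * Num.sqrt D) (C / h) 0 _ _ r16.
    move=> D D0; rewrite addr0 ger0_norm// mulr_ge0 ?sqrtr_ge0//.
    by rewrite divr_ge0 ?normr_ge0// ltW.
  exists (C1 + C2) => D D0.
  have T : `|tail_sum q D| <= 3 / 4 * rho * D + C / h * Num.sqrt D.
    apply: le_trans (ler_norm_sum _ _ _) _.
    exact: (tail_sum_le (q := fun D => `|q D|) (ltW rho0) (normr_ge0 _) HC).
  have := le_trans (ler_norm _) (H2 D D0); have := H1 D D0.
  rewrite -[q D in X in _ -> _ -> X](addrK (tail_sum q D)) => E1 E2.
  apply: le_trans (ler_normB _ _) _; lra.
have K0 : 0 <= K.
  have := le_trans (normr_ge0 _) (qK 0 (lexx 0)); by rewrite mulr0 add0r.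
(* Since [(k + 8) / (k + 9) >= 7 / 8], a harmonic sequence dominates the geometric decay, and the
   index for a given [e] can be read off. [K + 1] keeps the rate positive, as [step] demands. *)
have iter (k : nat) : bounded (8 * (K + 1) / (k%:R + 8)).
  have K1 : 0 < K + 1 by rewrite ltr_wpDl.
  elim: k => [|k [C HC]].
    exists K => D D0; apply: le_trans (qK D D0) _.
    by rewrite lerD2r ler_wpM2r// add0r mulrAC divff// mul1r lerDl.
  have k8 : 0 < k%:R + 8 :> R by rewrite ltr_wpDl.
  have [|C' HC'] := step _ _ (ex_intro _ C HC); first by rewrite divr_gt0// mulr_gt0.
  exists C' => D D0; apply: le_trans (HC' D D0) _.
  rewrite lerD2r ler_wpM2r// -(natr1 k) -subr_ge0.
  have -> : 8 * (K + 1) / (k%:R + 1 + 8) - 7 / 8 * (8 * (K + 1) / (k%:R + 8)) =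
     (K + 1) * (k%:R + 1) / ((k%:R + 1 + 8) * (k%:R + 8)).
    by field; rewrite !lt0r_neq0//; lra.
  by rewrite divr_ge0 ?mulr_ge0 ?(ltW k8) ?(ltW K1)//; lra.
move=> e e0; pose k := Num.truncn (8 * (K + 1) / e).
have [C HC] := iter k; exists C => D D0; apply: le_trans (HC D D0) _.
rewrite lerD2r ler_wpM2r// ler_pdivrMr ?ltr_wpDl// [e * _]mulrC -ler_pdivrMr//.
by have := truncnS_gt (8 * (K + 1) / e); rewrite -/k -(natr1 k); lra.
Qed.

End Contraction.

(** * Primitive lattice points by angle *)

Section CoprimePoints.
Variables (R : realType) (xi w h : R).
Hypotheses (w0 : 0 < w) (h0 : 0 < h).
Implicit Types (z : nat * int) (S : set R) (D : R).

Local Notation points := (points xi w h).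
Local Notation kappa := (kappa w h).

Definition cop z : bool := coprime z.1 `|z.2|%N.

Definition coprime_points D S : set (nat * int) := points D S `&` [set z | cop z].

Definition dilate (d : nat) z : nat * int := ((d * z.1)%N, d%:Z * z.2).

(** Dividing a point by its gcd [d] preserves the slope and divides the squared norm by [d ^+ 2]. *)
Lemma coprime_points_fiber D S (d : nat) : (0 < d)%N ->
  points D S `&` [set z | gcdn z.1 `|z.2|%N = d] =
  dilate d @` coprime_points (D / d%:R ^+ 2) S.
Proof.
move=> d0; have dR : 0 < d%:R :> R by rewrite ltr0n.
have sqd z : sqnorm xi w h (dilate d z) = sqnorm xi w h z * d%:R ^+ 2.
  by rewrite /sqnorm /px /py /= natrM intrM; ring.
have sld z : (0 < z.1)%N -> slope xi w h (dilate d z) = slope xi w h z.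
  move=> z0; rewrite /slope /px /py /= natrM intrM.
  by field; rewrite !lt0r_neq0// ltr0n.
apply/seteqP; split => z.
  move=> [[z0 zD zS] /= zd].
  have /dvdnP[m zm] : (d %| z.1)%N by rewrite -zd dvdn_gcdl.
  have /dvdzP[n zn] : (d%:Z %| z.2)%Z by rewrite -zd dvdzE dvdn_gcdr.
  have m0 : (0 < m)%N by move: z0; rewrite zm; case: (m).
  have zE : z = dilate d (m, n).
    by rewrite [z]surjective_pairing zm zn /dilate/= mulnC mulrC.
  exists (m, n) => //; split; first split => //.
  - by rewrite ler_pdivlMr ?exprn_gt0// -sqd -zE.
  - by rewrite -sld// -zE.
  - move: zd; rewrite zE /= abszM absz_nat -muln_gcdr => /eqP.
    by rewrite -{2}[d]muln1 eqn_pmul2l.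
move=> [z' [[z0 zD zS] zc] <-]; split.
  split; rewrite ?sqd ?sld//; first by rewrite /= muln_gt0 d0.
  by rewrite -ler_pdivlMr// exprn_gt0.
by rewrite /= abszM absz_nat -muln_gcdr; move/eqP: zc => ->; rewrite muln1.
Qed.

Lemma ncard_points_coprime D S : 0 <= D ->
  (ncard (points D S))%:R = (ncard (coprime_points D S))%:R +
    tail_sum h (fun D => (ncard (coprime_points D S))%:R) D.
Proof.
move=> D0; set M := Num.truncn (Num.sqrt D / h).
have fin (D' : R) : 0 <= D' -> finite_set (coprime_points D' S).
  by move=> D'0; apply: finite_setIl; exact: finite_points.
(* The gcd is at most [M]; the range [M.+2] leaves, after splitting off the empty fiber 0 and the
   primitive fiber 1, exactly the [M] terms of [tail_sum]. *)
rewrite (@ncard_fibers _ (fun z => gcdn z.1 `|z.2|%N) _ M.+2); last 2 first.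
- exact: finite_points.
- move=> z Pz; have [z0 _ _] := Pz; have [_ zY _] := points_sub_box h0 D0 Pz.
  rewrite ltnS; apply: leq_trans (py_le_row h0 (sqrtr_ge0 D) zY).
  by rewrite ltnW// ltnS dvdn_leq// dvdn_gcdl.
rewrite big_ord_recl/= (_ : points D S `&` _ = set0); last first.
  rewrite -subset0 => z [[z0 _ _] /= /eqP].
  by rewrite eqn0Ngt gcdn_gt0 z0.
rewrite {1}/ncard fset_set0 cardfs0 add0n.
have term (d : nat) : (0 < d)%N ->
    ncard (points D S `&` [set z | gcdn z.1 `|z.2|%N = d]) =
    ncard (coprime_points (D / d%:R ^+ 2) S).
  move=> d0; rewrite coprime_points_fiber// ncard_image//.
    by apply: fin; rewrite divr_ge0// exprn_ge0.
  move=> [a b] [a' b'] _ _ [/eqP + /eqP].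
  rewrite eqn_pmul2l// => /eqP ->; rewrite (inj_eq (mulfI _)); last by case: (d) d0.
  by move=> /eqP ->.
rewrite big_ord_recl/= term// expr1n divr1 natrD natr_sum; congr (_ + _).
by apply: eq_bigr => i _; rewrite term.
Qed.

Lemma coprime_points_le D S : 0 <= D ->
  (ncard (coprime_points D S) <= ncard (points D S))%N.
Proof. by move=> D0; apply: ncard_le; [exact: finite_points|exact: subIsetl]. Qed.

(** Keeps the denominator of the ratio of linear size. All points number at least [15 / 16 * L * D]
    and the tail at most [3 / 4 * (17 / 16) * L * D], up to lower-order terms, so a positive
    multiple of [D] remains. *)
Lemma coprime_points_ge (alpha beta : R) :
  - (pi / 2) <= alpha -> alpha < beta -> beta <= pi / 2 ->
  exists c C, 0 < c /\ forall D, 0 <= D ->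
    c * D - C <= (ncard (coprime_points D (atan_between alpha beta)))%:R.
Proof.
move=> alo ab bhi; pose L := kappa * (beta - alpha).
have L0 : 0 < L by rewrite mulr_gt0 ?subr_gt0// kappa_gt0.
have e0 : 0 < L / 16 by rewrite divr_gt0.
have [C HC] := points_atan_between xi w0 h0 alo (ltW ab) bhi (e := L / 16) e0.
have [|C' HC'] := @negligible_sqrt R (fun D => `|C| / h * Num.sqrt D) (`|C| / h) 0 _ _ e0.
  move=> D D0; rewrite addr0 ger0_norm// mulr_ge0 ?sqrtr_ge0//.
  by rewrite divr_ge0// ltW.
exists (L / 16), (C + C'); split => // D D0.
have Nle D' : 0 <= D' -> (ncard (coprime_points D' (atan_between alpha beta)))%:R
    <= (17 / 16 * L) * D' + `|C|.
  move=> D'0; have := coprime_points_le (atan_between alpha beta) D'0.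
  rewrite -(ler_nat R) => /le_trans; apply.
  have := HC D' D'0; rewrite -/L ler_norml => /andP[_]; have := ler_norm C; lra.
have L17 : 0 <= 17 / 16 * L by lra.
have T := tail_sum_le h0 L17 (normr_ge0 C) Nle D0.
have := HC D D0; rewrite -/L ncard_points_coprime// ler_norml => /andP[+ _].
have := le_trans (ler_norm _) (HC' D D0).
have := mulr_ge0 (ltW L0) D0; lra.
Qed.

Lemma coprime_points_proportion (alpha1 beta1 alpha2 beta2 : R) :
  - (pi / 2) <= alpha1 -> alpha1 <= beta1 -> beta1 <= pi / 2 ->
  - (pi / 2) <= alpha2 -> alpha2 < beta2 -> beta2 <= pi / 2 ->
  negligible (fun D => (ncard (coprime_points D (atan_between alpha1 beta1)))%:R
    - (beta1 - alpha1) / (beta2 - alpha2) *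
      (ncard (coprime_points D (atan_between alpha2 beta2)))%:R).
Proof.
move=> a1 ab1 b1 a2 ab2 b2; set lambda := _ / _.
have ba2 : 0 < beta2 - alpha2 by rewrite subr_gt0.
have lam0 : 0 <= lambda by rewrite divr_ge0 ?subr_ge0// ltW.
have [C HC] := points_total_le xi w0 h0 (ltr01 : 0 < 1).
have k0 := kappa_gt0 w0 h0.
have Ple S D : 0 <= D ->
    (ncard (coprime_points D S))%:R <= (kappa * pi + 1) * D + C.
  move=> D0; rewrite mulrDl; apply: le_trans (HC D D0).
  rewrite ler_nat; apply: leq_trans (coprime_points_le S D0) _.
  by apply: ncard_le; [exact: finite_points|move=> z []].
(* A crude constant serving both as slope and as intercept of the initial linear bound. *)
pose K := (1 + lambda) * (kappa * pi + 1 + `|C|).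
apply: (negligible_of_tail_sum h0 (K := K)).
  move=> D D0; apply: le_trans (ler_normB _ _) _.
  rewrite normrM !normr_nat (ger0_norm lam0).
  have P1le := Ple (atan_between alpha1 beta1) D D0.
  have P2le := ler_wpM2l lam0 (Ple (atan_between alpha2 beta2) D D0).
  apply: le_trans (lerD P1le P2le) _.
  have kp : 0 <= kappa * pi by rewrite mulr_ge0 ?pi_ge0// ltW.
  rewrite -{1}[_ * D + C]mul1r -mulrDl /K -mulrA -mulrDr ler_wpM2l ?addr_ge0//.
  have := ler_norm C; have := mulr_ge0 (normr_ge0 C) D0; lra.
have n1 := points_atan_between xi w0 h0 a1 ab1 b1.
have n2 := points_atan_between xi w0 h0 a2 (ltW ab2) b2.
have nN := negligibleD n1 (negligibleZ (- lambda) n2).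
move=> e e0; have [C' HC'] := nN e e0; exists C' => D D0.
(* The discrepancy plus its tail is the discrepancy for all points, whose area terms cancel by the
   choice of [lambda]. *)
apply: le_trans (HC' D D0); rewrite le_eqVlt; apply/orP; left; apply/eqP.
congr (`| _ |); rewrite !ncard_points_coprime// /tail_sum sumrB -mulr_sumr.
rewrite /lambda; field; exact: lt0r_neq0.
Qed.

Lemma cvg_coprime_points_ratio (alpha1 beta1 alpha2 beta2 : R) :
  - (pi / 2) <= alpha1 -> alpha1 <= beta1 -> beta1 <= pi / 2 ->
  - (pi / 2) <= alpha2 -> alpha2 < beta2 -> beta2 <= pi / 2 ->
  (ncard (coprime_points D (atan_between alpha1 beta1)))%:R /
  (ncard (coprime_points D (atan_between alpha2 beta2)))%:R
    @[D --> +oo] --> (beta1 - alpha1) / (beta2 - alpha2).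
Proof.
move=> a1 ab1 b1 a2 ab2 b2.
have [c [C [c0 HC]]] := coprime_points_ge a2 ab2 b2.
have nq := coprime_points_proportion a1 ab1 b1 a2 ab2 b2.
set lambda := _ / (beta2 - _) in nq *.
apply/cvgrPdist_le => e e0.
(* For large [D] both [d * D] and [C'] are at most [e * c / 4 * D], with [d] this constant; together
   they stay below [e * P2], because [P2 >= c * D / 2]. *)
have d0 : 0 < e * c / 4 by rewrite divr_gt0// mulr_gt0.
have [C' HC'] := nq _ d0.
near=> D.
have D0 : 0 <= D by near: D; apply: nbhs_pinfty_ge; rewrite num_real.
have D1 : 2 * (`|C| + 1) / c <= D by near: D; apply: nbhs_pinfty_ge; rewrite num_real.
have D2 : 4 * `|C'| / (e * c) <= D by near: D; apply: nbhs_pinfty_ge; rewrite num_real.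
rewrite ler_pdivrMr// in D1; rewrite ler_pdivrMr ?mulr_gt0// in D2.
have := HC D D0; have := HC' D D0.
set P1 := (ncard (coprime_points D (atan_between alpha1 _)))%:R.
set P2 := (ncard (coprime_points D (atan_between alpha2 _)))%:R => Hq Hc.
have cC : c * D / 2 <= P2 by have := ler_norm C; lra.
have P20 : 0 < P2.
  have := ler_norm C; have := normr_ge0 C; lra.
rewrite (_ : lambda - P1 / P2 = - (P1 - lambda * P2) / P2); last first.
  by field; rewrite lt0r_neq0.
rewrite normrM normfV normrN (gtr0_norm P20) ler_pdivrMr//.
apply: le_trans Hq _; apply: le_trans (ler_wpM2l (ltW e0) cC).
have := ler_norm C'; lra.
Unshelve. all: by end_near.
Qed.

End CoprimePoints.

(** * The lattice of forms attached to a CM point *)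

Section IntegerLattice.
Implicit Types a b c m n x y : int.

(** The least positive element generates: a remainder modulo it lies in [S] and is smaller, hence is
    0. *)
Lemma int_subgroup_generator (S : int -> Prop) n : 0 < n -> S n ->
  (forall x y, S x -> S y -> S (x - y)) ->
  exists g, [/\ 0 < g, S g & forall x, S x -> exists k, x = k * g].
Proof.
move=> n0 Sn SB.
have ex : exists k : nat, `[<S k.+1%:Z>].
  by exists `|n|.-1%N; apply/asboolP; rewrite prednK ?absz_gt0 ?gt_eqF// gtz0_abs.
case: (ex_minnP ex) => g0 /asboolP Sg gmin; set g : int := g0.+1%:Z in Sg *.
have S0 : S 0 by rewrite -(subrr n); exact: SB.
have SN x : S x -> S (- x) by move=> Sx; rewrite -sub0r; exact: SB.
have SD x y : S x -> S y -> S (x + y).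
  by move=> Sx Sy; rewrite -(opprK y); apply: SB => //; exact: SN.
have SMn (k : nat) : S (k%:Z * g).
  by elim: k => [|k IH]; [rewrite mul0r|rewrite -addn1 PoszD mulrDl mul1r; exact: SD].
have SM k : S (k * g).
  by case: k => k; [exact: SMn|rewrite NegzE mulNr; apply: SN; exact: SMn].
exists g; split => // x Sx; exists (x %/ g)%Z.
have Sr : S (x %% g)%Z by rewrite /modz; exact: SB.
have r0 : (0 <= x %% g)%Z by rewrite modz_ge0.
have rg : ((x %% g)%Z < g) by rewrite ltz_pmod.
rewrite {1}(divz_eq x g) -[RHS]addr0; congr (_ + _).
move: r0 rg Sr; case: (x %% g)%Z => // -[//|k] _ kg Sk.
have /gmin : `[<S k.+1%:Z>] by exact/asboolP.
rewrite /g in kg; lia.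
Qed.

(* Equals [2 * A * (a * |p|^2 + b * Re p + c)] when [p] is a nonreal root of
   [A z^2 + B z + C]. *)
Definition polar_form A B C a b c : int := 2 * a * C - b * B + 2 * c * A.

(** A triangular basis: [a0] generates the possible first coefficients, [w] the second ones once the
    first is 0, and the equation then determines [c] as [A] is nonzero. The solutions [(A, 0, - C)]
    and [(0, 2 * A, B)] show that both groups are nontrivial. *)
Lemma polar_form_basis A B C : 0 < A ->
  exists a0 b0 c0 w c1, [/\ 0 < a0, 0 < w,
    polar_form A B C a0 b0 c0 = 0, polar_form A B C 0 w c1 = 0 &
    forall a b c, polar_form A B C a b c = 0 -> exists m n,
      [/\ a = m * a0, b = m * b0 + n * w & c = m * c0 + n * c1]].
Proof.
rewrite /polar_form => A0.
have [|||a0 [a00 [b0 [c0 L0]] a0P]] :=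
  @int_subgroup_generator (fun a => exists b c, 2 * a * C - b * B + 2 * c * A = 0) A.
- exact: A0.
- by exists 0, (- C); ring.
- move=> x y [b [c H]] [b' [c' H']]; exists (b - b'), (c - c').
  lra.
have [|||w [w0 [c1 L1]] wP] :=
  @int_subgroup_generator (fun b => exists c, 2 * 0 * C - b * B + 2 * c * A = 0) (2 * A).
- by rewrite mulr_gt0.
- by exists B; ring.
- move=> x y [c H] [c' H']; exists (c - c').
  lra.
exists a0, b0, c0, w, c1; split => // a b c L.
have [|m am] := a0P a; first by exists b, c.
have [|n bn] := wP (b - m * b0).
  exists (c - m * c0).
  by have L0m := congr1 (GRing.mul m) L0; rewrite am in L; lra.
have bE : b = m * b0 + n * w by rewrite -bn; ring.
exists m, n; split => //; apply: (@mulfI _ (2 * A)); first by rewrite mulf_neq0 // lt0r_neq0.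
have L0m := congr1 (GRing.mul m) L0; have L1n := congr1 (GRing.mul n) L1.
by rewrite am bE in L; lra.
Qed.

End IntegerLattice.

(** * Semicircles and their angles *)

Section Semicircles.
Variable R : realType.
Implicit Types (q r t x y : R) (p : R[i]).
Local Open Scope complex_scope.

Lemma polarE q r t : polar q r t = (q + r * cos t) +i* (r * sin t).
Proof. by rewrite /polar; simpc. Qed.

Lemma sin_gt0_itv t : t \in `]0, pi[ -> 0 < sin t.
Proof. by rewrite in_itv; exact: sin_gt0_pi. Qed.

Lemma semicircle_mem q r x y : semicircle q r (x +i* y) ->
  (x - q) ^+ 2 + y ^+ 2 = r ^+ 2.
Proof.
move=> [t _]; rewrite polarE => -[<- <-].
by rewrite -[r ^+ 2 in RHS]mulr1 -(cos2Dsin2 t); ring.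
Qed.

(** The top point of each semicircle lies on the other; adding the two circle equations leaves
    [2 * (q - q') ^+ 2 = 0]. *)
Lemma semicircle_inj q r q' r' : 0 < r -> 0 < r' ->
  semicircle q r = semicircle q' r' -> q = q' /\ r = r'.
Proof.
have top (u v : R) : semicircle u v (u +i* v).
  exists (pi / 2); last by rewrite /= polarE cos_pihalf sin_pihalf mulr0 addr0 mulr1.
  by rewrite /= in_itv/=; have := pi_gt0 R; move=> ?; apply/andP; split; lra.
move=> r0 r'0 E.
have H1 : semicircle q' r' (q +i* r) by rewrite -E.
have H2 : semicircle q r (q' +i* r') by rewrite E.
move/semicircle_mem in H1; move/semicircle_mem in H2.
have qq : (q - q') ^+ 2 = 0 by have := sqr_ge0 (q - q'); nra.
move/eqP: (qq); rewrite sqrf_eq0 subr_eq0 => /eqP qE; split => //.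
by apply/eqP; rewrite -(eqrXn2 (n := 2))// ?ltW//; apply/eqP; lra.
Qed.

Lemma ang_semicircle q r t : 0 < r -> t \in `]0, pi[ ->
  ang (polar q r t) (semicircle q r) = t.
Proof.
move=> r0 tI; rewrite /ang; set P := [set _ | _].
have Pt : P t by split => //; exists q, r.
have [sI [q' [r' [r'0 E pE]]]] : P (get P) by exact: (getPex (ex_intro P t Pt)).
have [qq rr] := semicircle_inj r0 r'0 E.
move: pE; rewrite -qq -rr !polarE => -[/addrI /(mulfI (lt0r_neq0 r0)) ct _].
by symmetry; apply: cos_inj => //; apply: subset_itv_oo_cc.
Qed.

(** [pi / 2 - atan] is the arccotangent with values in [(0, pi)], so it turns slopes into polar
    angles. *)
Lemma atan_cot t : t \in `]0, pi[ -> pi / 2 - atan (cos t / sin t) = t.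
Proof.
move=> tI; have st := sin_gt0_itv tI.
rewrite in_itv/= in tI; case/andP: tI => t0 tpi.
have -> : cos t / sin t = tan (pi / 2 - t).
  by rewrite /tan -opprB sinN cosN sinBpihalf cosBpihalf opprK.
rewrite tanK ?in_itv/=; [ring|apply/andP; split; lra].
Qed.

End Semicircles.

(** * RM curves through a CM point as primitive lattice points *)

Section Angles.
Variable R : realType.
Implicit Types (p : R[i]) (f : bqf) (D : R).
Local Open Scope complex_scope.

Lemma complex_int (k : int) : k%:~R = (k%:~R : R)%:C.
Proof. by rewrite rmorph_int. Qed.

Lemma disc_intr f : (disc f)%:~R =
  (coefb f)%:~R ^+ 2 - 4 * (coefa f)%:~R * (coefc f)%:~R :> R.
Proof. by rewrite /disc rmorphB rmorphXn !rmorphM. Qed.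

(** The imaginary part of the root equation, divided by [y], gives the trace of [p]; the real part
    then gives its norm. A negative discriminant excludes [A = 0]. *)
Lemma CM_point_coefs p : CM_point p ->
  exists A B C : int, [/\ 0 < A,
    2 * A%:~R * complex.Re p = - B%:~R &
    A%:~R * (complex.Re p ^+ 2 + complex.Im p ^+ 2) = C%:~R].
Proof.
case: p => x y [y0 [[A B C] [[_ +] disc_lt0 rootp]]]; rewrite /disc/= in disc_lt0 * => nf.
have A0 : 0 < A.
  case: nf => [//|[A0 _]|[A0 _ _]]; move: disc_lt0;
    by rewrite A0 mulr0 mul0r subr0 ltNge sqr_ge0.
exists A, B, C; split => //; move: rootp; rewrite /bqf_root/= !complex_int expr2;
  simpc => -[re im].
  apply: (@mulIf _ y); first exact: lt0r_neq0.
  lra.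
have Bx : 2 * A%:~R * x = - B%:~R.
  apply: (@mulIf _ y); first exact: lt0r_neq0.
  lra.
have := congr1 (fun u => u * x) Bx; lra.
Qed.

Lemma eq_coprime_ratio (m m' : nat) (n n' : int) :
  (0 < m)%N -> (0 < m')%N -> coprime m `|n| -> coprime m' `|n'| ->
  n * m'%:Z = n' * m%:Z -> m = m' /\ n = n'.
Proof.
move=> m0 m'0 cmn cmn' E.
have Eabs : (`|n| * m' = `|n'| * m)%N by rewrite -[m']absz_nat -[m]absz_nat -!abszM E.
have mm' : m = m'.
  apply/eqP; rewrite eqn_dvd; apply/andP; split.
    by rewrite -(Gauss_dvdr _ cmn) Eabs dvdn_mull.
  by rewrite -(Gauss_dvdr _ cmn') -Eabs dvdn_mull.
split => //; move: E; rewrite mm' => /mulIf; apply.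
by rewrite eqz_nat -lt0n.
Qed.

Lemma sub_atan_itv (s : R) : pi / 2 - atan s \in `]0, pi[.
Proof.
rewrite in_itv/=; have := atan_gtNpi2 s; have := atan_ltpi2 s => ? ?.
by apply/andP; split; lra.
Qed.

Lemma ang_RM_coprime_points p : CM_point p ->
  exists xi w h : R, [/\ 0 < w, 0 < h & forall D, 0 <= D ->
    ang_RM p D = (fun z => pi / 2 - atan (slope xi w h z)) @`
      coprime_points xi w h D setT].
Proof.
move=> CMp; have [A [B [C [A0 ABx ACn]]]] := CM_point_coefs CMp.
have [] := CMp; case: p CMp ABx ACn => x y /= _ ABx ACn y0 _.
have [a0 [b0 [c0 [w [c1 [a00 w0 L0 L1 LP]]]]]] := polar_form_basis B C A0.
pose polr a b c : R := a%:~R * (x ^+ 2 + y ^+ 2) + b%:~R * x + c%:~R.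
have AR : 0 < A%:~R :> R by rewrite ltr0z.
have polrE a b c : 2 * A%:~R * polr a b c = (polar_form A B C a b c)%:~R.
  rewrite /polar_form /polr !(intrD, intrB, intrM, rmorphN) -ACn.
  have := congr1 (fun u => b%:~R * u) ABx; lra.
have A2 : 2 * A%:~R != 0 :> R by rewrite mulf_neq0// lt0r_neq0.
have polr0 a b c : polar_form A B C a b c = 0 <-> polr a b c = 0.
  split => H; first by apply: (mulfI A2); rewrite polrE H mulr0.
  by apply/eqP; rewrite -(intr_eq0 R) -polrE H mulr0.
have a0R : 0 < a0%:~R :> R by rewrite ltr0z.
have wR : 0 < w%:~R :> R by rewrite ltr0z.
(* The basis vectors [(a0, b0, c0)] and [(0, w, c1)] are sent by [(2 a x + b, 2 a y)] to [(xi, h)]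
   and [(w, 0)]. *)
pose xi : R := 2 * a0%:~R * x + b0%:~R.
pose h : R := 2 * a0%:~R * y.
have h0 : 0 < h by rewrite !mulr_gt0.
exists xi, w%:~R, h; split => // D D0.
pose fa (m n : int) := m * a0; pose fb m n := m * b0 + n * w.
pose fc m n := m * c0 + n * c1.
have fpol m n : polar_form A B C (fa m n) (fb m n) (fc m n) = 0.
  transitivity (m * polar_form A B C a0 b0 c0 + n * polar_form A B C 0 w c1).
    by rewrite /polar_form /fa /fb /fc; ring.
  by rewrite L0 L1 !mulr0 addr0.
have pxE (m : nat) n : px xi w%:~R (m, n) = 2 * (fa m n)%:~R * x + (fb m n)%:~R.
  by rewrite /px /xi /fa /fb /= !(intrD, intrM); ring.
have pyE (m : nat) n : py h (m, n) = 2 * (fa m n)%:~R * y.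
  by rewrite /py /h /fa /= !intrM; ring.
have sqE (m : nat) n : sqnorm xi w%:~R h (m, n) =
    (disc (Bqf (fa m n) (fb m n) (fc m n)))%:~R.
  rewrite /sqnorm pxE pyE disc_intr/=.
  have /polr0 := fpol m n; rewrite /polr.
  move: (fa m n) (fb m n) (fc m n) => a b c E.
  (* Multiplying the incidence relation by [4 a] turns [(2 a x + b)^2 + (2 a y)^2] into
     [b^2 - 4 a c]. *)
  have := congr1 (fun u => 4 * a%:~R * u) E; lra.
apply/seteqP; split => [_ [G [Gp [d [f [q [r [[nf d0 a_neq0 dE] [r0 rm rp GE]]]]] dD]] <-]|t0].
  case: f nf d0 a_neq0 dE rm rp => a b c [/= gcd1 sgn] d0 a_neq0 dE.
  rewrite /bqf_root/= => rm rp.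
  have apos : 0 < a.
    by case: sgn a_neq0 => [//|[->]|[->]]; rewrite ?eqxx.
  have aR : 0 < a%:~R :> R by rewrite ltr0z.
  (* Subtract the root equations at [q - r] and [q + r], and cancel [r]. *)
  have bE : b%:~R = - (2 * a%:~R * q).
    apply: (@mulIf _ r); first exact: lt0r_neq0.
    lra.
  have cE : c%:~R = a%:~R * (q ^+ 2 - r ^+ 2) by move: rm; rewrite bE; lra.
  rewrite GE in Gp *.
  have /semicircle_mem circ := Gp.
  have [t tI pE] := Gp; rewrite /= in pE.
  have st := sin_gt0_itv tI.
  rewrite -pE ang_semicircle//.
  move: pE; rewrite polarE => -[xE yE].
  have /polr0 /LP [m [n [am bn cn]]] : polr a b c = 0.
    by rewrite /polr bE cE -[y ^+ 2](addrK ((x - q) ^+ 2)) [y ^+ 2 + _]addrC circ; ring.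
  have m0 : 0 < m by rewrite -(pmulr_lgt0 _ a00) -am.
  have mE : m = `|m|%N%:Z by rewrite gtz0_abs.
  have [aE bE' cE'] : [/\ a = fa `|m|%N n, b = fb `|m|%N n & c = fc `|m|%N n].
    by rewrite /fa /fb /fc -mE.
  exists (`|m|%N, n).
    split; first split => //=; first by rewrite absz_gt0 gt_eqF.
      by rewrite sqE -aE -bE' -cE' dE.
    rewrite /cop /= /coprime -dvdn1.
    (* A common divisor of the coordinates [m], [n] divides [a], [b] and [c], whose gcd is 1. *)
    set g := gcdn _ _.
    have gm : (g%:Z %| m)%Z by rewrite dvdzE dvdn_gcdl.
    have gn : (g%:Z %| n)%Z by rewrite dvdzE dvdn_gcdr.
    have : (g%:Z %| gcdz a (gcdz b c))%Z.
      rewrite !dvdz_gcd am bn cn; apply/and3P; split.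
      - exact: dvdz_mulr.
      - by rewrite rpredD ?dvdz_mulr.
      - by rewrite rpredD ?dvdz_mulr.
    by rewrite gcd1 dvdzE.
  (* The slope [(2 a x + b) / (2 a y)] equals [(x - q) / y], the cotangent of [t]. *)
  rewrite -[RHS](atan_cot tI); congr (_ - atan _).
  rewrite /slope pxE pyE -aE -bE' bE -xE -yE.
  by field; rewrite !lt0r_neq0.
(* Conversely, a primitive point yields a form; its semicircle has centre [q] and radius [r] given
   by the quadratic formula. *)
move=> [[m n] [[/= m0 zD _] zc] <-].
set a := fa m n; set b := fb m n; set c := fc m n.
have m0Z : 0 < m%:Z by [].
have apos : 0 < a by rewrite mulr_gt0.
have aR : 0 < a%:~R :> R by rewrite ltr0z.
set s := slope _ _ _ _; set t := _ - _.
have tI : t \in `]0, pi[ by exact: sub_atan_itv.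
have py0 := py_gt0 h0 (z := (m, n)) m0.
have disc0 : 0 < (disc (Bqf a b c))%:~R :> R.
  rewrite -sqE /sqnorm ltr_wpDl ?sqr_ge0// exprn_gt0//.
pose q : R := - b%:~R / (2 * a%:~R).
pose r : R := Num.sqrt (disc (Bqf a b c))%:~R / (2 * a%:~R).
have r0 : 0 < r by rewrite divr_gt0 ?sqrtr_gt0// mulr_gt0.
have s1 : 0 < 1 + s ^+ 2 by rewrite ltr_pwDl// sqr_ge0.
have rE : r = y * Num.sqrt (1 + s ^+ 2).
  rewrite /r -sqE (sqnormE xi _ h0)// sqrtrM ?sqr_ge0// sqrtr_sqr (gtr0_norm py0) pyE.
  by rewrite -/a -/s; field; exact: lt0r_neq0.
have sq0 : Num.sqrt (1 + s ^+ 2) != 0 by rewrite lt0r_neq0// sqrtr_gt0.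
have sinE : r * sin t = y.
  rewrite /t -opprB sinN sinBpihalf opprK cos_atan rE.
  by field.
have cosE : r * cos t = x - q.
  have catan : cos (atan s) != 0 by rewrite cos_atan invr_eq0.
  rewrite /t -opprB cosN cosBpihalf -[sin _](divfK catan) -/(tan _) atanK cos_atan rE.
  rewrite mulrCA -!mulrA mulfV// mulr1 /s /slope pxE pyE /q -/a -/b.
  by field; rewrite !lt0r_neq0.
have pE : x +i* y = polar q r t by rewrite polarE sinE cosE addrC subrK.
exists (semicircle q r); last by rewrite pE ang_semicircle.
split; first by exists t.
exists (disc (Bqf a b c)); last by rewrite -sqE.
have discE : (disc (Bqf a b c))%:~R = 4 * a%:~R ^+ 2 * r ^+ 2 :> R.
  rewrite /r expr_div_n sqr_sqrtr ?(ltW disc0)//.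
  by field; exact: lt0r_neq0.
have bE : b%:~R = - (2 * a%:~R * q) by rewrite /q; field; exact: lt0r_neq0.
have cE : c%:~R = a%:~R * (q ^+ 2 - r ^+ 2).
  apply: (@mulfI _ (4 * a%:~R)); first by rewrite mulf_neq0// lt0r_neq0.
  move: discE; rewrite disc_intr/= bE; lra.
exists (Bqf a b c), q, r; split; split => //=.
- split; last exact: Or31.
  (* The form divided by its content [g] still satisfies the incidence relation, so it has integral
     coordinates [m'], [n']; hence [g] divides both [m] and [n], which are coprime. *)
  set g := gcdz _ _.
  have gE : g = `|g|%N%:Z by rewrite gez0_abs.
  have ga : (g %| a)%Z by rewrite dvdz_gcdl.
  have gbc : (g %| gcdz b c)%Z by rewrite dvdz_gcdr.
  have gb : (g %| b)%Z by apply: dvdz_trans gbc _; rewrite dvdz_gcdl.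
  have gc : (g %| c)%Z by apply: dvdz_trans gbc _; rewrite dvdz_gcdr.
  have g0 : g != 0 by rewrite gcdz_eq0 gt_eqF.
  have /dvdzP[a' aE] := ga; have /dvdzP[b' bE'] := gb; have /dvdzP[c' cE'] := gc.
  have /LP [m' [n' [am' bm' _]]] : polar_form A B C a' b' c' = 0.
    apply: (mulIf g0); rewrite mul0r -(fpol m n) -/a -/b -/c aE bE' cE'.
    by rewrite /polar_form; ring.
  have mE : m%:Z = m' * g.
    apply: (@mulIf _ a0); first by rewrite gt_eqF.
    by rewrite -[LHS]/a aE am'; ring.
  have nE : n = n' * g.
    apply: (@mulIf _ w); first by rewrite gt_eqF.
    have : b = b' * g by [].
    by rewrite /b /fb bm' mE; lra.
  have : (`|g| %| gcdn m `|n|)%N.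
    by rewrite dvdn_gcd -[m]absz_nat mE nE !abszM !dvdn_mull.
  by rewrite (eqP zc) dvdn1 gE => /eqP ->.
- by rewrite -(ltr0z R).
- by rewrite gt_eqF.
- by rewrite /bqf_root/= bE cE; ring.
- by rewrite /bqf_root/= bE cE; ring.
Qed.

(** Points of equal slope are proportional, and primitivity with positive row index makes them
    equal. Counting angles is therefore counting primitive points. *)
Lemma slope_inj (xi w h : R) D S : 0 < w -> 0 < h ->
  forall z z', coprime_points xi w h D S z -> coprime_points xi w h D S z' ->
  slope xi w h z = slope xi w h z' -> z = z'.
Proof.
move=> w0 h0 [m n] [m' n'] [[/= m0 _ _] mn] [[/= m'0 _ _] mn'].
have mR : 0 < m%:R :> R by rewrite ltr0n.
have m'R : 0 < m'%:R :> R by rewrite ltr0n.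
rewrite /slope /px /py /= => E.
have [] := @eq_coprime_ratio m m' n n' m0 m'0 mn mn'; last by move=> -> ->.
apply/eqP; rewrite -(eqr_int R) !intrM; apply/eqP.
apply: (@mulfI _ w); first exact: lt0r_neq0.
have {}E : (xi * m%:R + w * n%:~R) * m'%:R = (xi * m'%:R + w * n'%:~R) * m%:R.
  have h1 := lt0r_neq0 (mulr_gt0 h0 mR); have h2 := lt0r_neq0 (mulr_gt0 h0 m'R).
  move/eqP: E; rewrite eqr_div// => /eqP E.
  apply: (@mulIf _ h); first exact: lt0r_neq0.
  lra.
rewrite -[m'%:~R]/(m'%:R) -[m%:~R]/(m%:R); lra.
Qed.

End Angles.

(** * Equidistribution of the angles *)

Theorem theorem1p3 (R : realType) (p : R[i]) (hp : CM_point p)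
    (a1 b1 a2 b2 : R) (h1 : a1 <= b1) (h2 : a2 < b2)
    (h12 : `[a1, b1] `<=` `[a2, b2]) (h2pi : `[a2, b2] `<=` `[0, pi]) :
  (angle_count p Delta `[a1, b1])%:R / (angle_count p Delta `[a2, b2])%:R
    @[Delta --> +oo] --> (b1 - a1) / (b2 - a2).
Proof.
have [xi [w [h [w0 h0 angE]]]] := ang_RM_coprime_points hp.
(* The angle is [pi / 2] minus the arctangent of the slope, so the ends of the interval are
   reflected and exchanged. *)
have count (a b D : R) : 0 <= D -> angle_count p D `[a, b] =
    ncard (coprime_points xi w h D (atan_between (pi / 2 - b) (pi / 2 - a))).
  move=> D0; rewrite /angle_count angE// -/(ncard _).
  pose phi (z : nat * int) : R := pi / 2 - atan (slope xi w h z).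
  rewrite -(@ncard_image _ _ phi (coprime_points _ _ _ _ _)).
  - congr ncard; apply/seteqP; split => t.
      move=> [/= tI [z [zP zc] zt]]; exists z => //; split => //.
      case: zP => z0 zD _; split => //; rewrite /atan_between/=.
      by move: tI; rewrite in_itv/= -zt /phi => /andP[? ?]; apply/andP; split; lra.
    move=> [z [[z0 zD zS] zc] <-]; split; last by exists z.
    move: zS; rewrite /atan_between/= in_itv/= /phi => /andP[? ?].
    by apply/andP; split; lra.
  - by apply: finite_setIl; exact: finite_points.
  - move=> z z' Pz Pz' /addrI /oppr_inj /(can_inj (@atanK R)).
    exact: slope_inj Pz Pz'.
have in2 t : a2 <= t <= b2 -> 0 <= t <= pi.
  by move=> tI; have := h2pi t; rewrite /= !in_itv/=; exact.
have in1 t : a1 <= t <= b1 -> a2 <= t <= b2.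
  by move=> tI; have := h12 t; rewrite /= !in_itv/=; exact.
have /andP[a20 _] : 0 <= a2 <= pi by apply: in2; rewrite lexx ltW.
have /andP[_ b2pi] : 0 <= b2 <= pi by apply: in2; rewrite lexx ltW.
have /andP[a21 _] : a2 <= a1 <= b2 by apply: in1; rewrite lexx.
have /andP[_ b12] : a2 <= b1 <= b2 by apply: in1; rewrite lexx andbT.
have -> : (b1 - a1) / (b2 - a2) =
    ((pi / 2 - a1) - (pi / 2 - b1)) / ((pi / 2 - a2) - (pi / 2 - b2)).
  by congr (_ / _); ring.
apply: cvg_trans (cvg_coprime_points_ratio xi w0 h0 _ _ _ _ _ _); try lra.
(* The two counts agree for nonnegative [Delta], hence eventually. *)
apply: near_eq_cvg.
by near=> D; rewrite !count//; near: D; apply: nbhs_pinfty_ge; rewrite num_real.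
Unshelve. all: by end_near.
Qed.
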